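(* Let $X$ be a distance-regular graph of diameter $d\geq 2$ with intersection numbers $b_i,c_i$. Let $0\leq j\leq d-2$, assume $b_j>c_{j+1}$, and put $C=b_j/c_{j+1}$. Then for every $1\leq s\leq j+1$, $$b_{j+1}\left(\sum_{t=1}^{s}\frac{1}{b_{t-1}}+\sum_{t=1}^{j+2-s}\frac{1}{b_{t-1}}\right)+c_{j+2}\sum_{t=1}^{j+1}\frac{1}{b_{t-1}}\geq 1-\frac{4}{C-1}.$$
   Context: A connected graph $X$ of diameter $d$ is distance-regular if there are integers $a_i,b_i,c_i$ ($0\le i\le d$) such that for all vertices $v,w$ with $\mathrm{dist}(v,w)=i$, the vertex $w$ has exactly $c_i$ neighbours at distance $i-1$ from $v$, $a_i$ neighbours at distance $i$ from $v$, and $b_i$ neighbours at distance $i+1$ from $v$. Then $X$ is $k$-regular with $k=b_0$, $c_0=b_d=0$, $c_1=1$ and $a_i+b_i+c_i=k$. *)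

(* Defs.v *)
From HB Require Import structures.
From mathcomp Require Import all_boot all_order all_algebra.
Set Implicit Arguments. Unset Strict Implicit. Unset Printing Implicit Defensive.

Fixpoint ball (T : finType) (e : rel T) (n : nat) (v : T) : {set T} :=
  match n with
  | 0 => [set v]
  | n'.+1 => ball e n' v :|: [set y | [exists z in ball e n' v, e z y]]
  end.

Definition gdist (T : finType) (e : rel T) (v w : T) (i : nat) : bool :=
  (w \in ball e i v) && ((i == 0) || (w \notin ball e i.-1 v)).

Definition distance_regular (T : finType) (e : rel T) (d : nat)
    (a b c : nat -> nat) : Prop :=
  [/\ symmetric e, irreflexive e,
      (forall v w : T, exists2 i, i <= d & gdist e v w i),
      (exists v w : T, gdist e v w d) &
      (forall (i : nat) (v w : T), i <= d -> gdist e v w i ->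
         [/\ #|[set u | e w u & (0 < i) && gdist e v u i.-1]| = c i,
             #|[set u | e w u & gdist e v u i]| = a i &
             #|[set u | e w u & gdist e v u i.+1]| = b i])].

(* Main.v *)
(**
  Put h = j + 1, take v, w at distance h + 1 and u on a geodesic between them with
  d(u, v) = s. The sphere S_h(u), of size k_h, is covered by B_h(u) \ B_h(v),
  B_h(u) \ B_h(w), B_j(v) and F = S_h(v) ∩ B_h(w).
  - For an edge xy, |B_h(x) \ B_h(y)| = k_h b_h / b_0; summing along geodesics bounds
    the first two sets by s k_h b_h / b_0 and (j + 2 - s) k_h b_h / b_0, and
    1 / b_0 <= 1 / b_{t-1}.
  - A random geodesic from v to S_h(v) enters B_h(w) at its t-th step with probability
    at most c_{h+1} / b_{t-1}, which bounds |F| / k_h.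
  - The sphere sizes grow by a factor at least C up to radius h, so
    |B_j(v)| / k_h <= 1 / (C - 1).
*)
Require Import Defs.
From HB Require Import structures.
From mathcomp Require Import all_boot all_order all_algebra.
From mathcomp Require Import zify ring lra.
Import Order.TTheory GRing.Theory Num.Theory.
Local Open Scope ring_scope.

(** * Balls: monotonicity, symmetry, edge counting *)

Section Ball.
Local Open Scope nat_scope.
Context {T : finType} {e : rel T}.
Implicit Types (u v w x y z : T) (m n i : nat).

Lemma mem_ballS n v w :
  (w \in ball e n.+1 v) = (w \in ball e n v) || [exists z in ball e n v, e z w].
Proof. by rewrite /= !inE. Qed.

Lemma ball_mono m n v w : m <= n -> w \in ball e m v -> w \in ball e n v.
Proof.
move=> /subnKC <-; elim: (n - m) => [|k IH] h; first by rewrite addn0.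
by rewrite addnS mem_ballS IH.
Qed.

Lemma ball_edge n v z w : z \in ball e n v -> e z w -> w \in ball e n.+1 v.
Proof.
by move=> hz ezw; rewrite mem_ballS; apply/orP; right; apply/exists_inP; exists z.
Qed.

(** [ball] grows at its outer end; prepending an edge at the centre instead is what reverses a walk
    in [ball_sym]. *)
Lemma ball_edge_center n v z w : e v z -> w \in ball e n z -> w \in ball e n.+1 v.
Proof.
move=> evz; elim: n w => [|n IH] w.
  rewrite inE => /eqP ->; apply: ball_edge evz; exact: set11.
rewrite mem_ballS => /orP [/IH|/exists_inP [y /IH hy eyw]]; first exact: ball_mono.
exact: ball_edge hy eyw.
Qed.

Lemma ball_sym n v w : symmetric e -> w \in ball e n v -> v \in ball e n w.
Proof.
move=> esym; elim: n w => [|n IH] w; first by rewrite !inE eq_sym.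
rewrite mem_ballS => /orP [/IH|/exists_inP [z /IH hz ezw]]; first exact: ball_mono.
by apply: ball_edge_center hz; rewrite esym.
Qed.

Lemma gdist_inj v w m n : gdist e v w m -> gdist e v w n -> m = n.
Proof.
wlog lt_mn : m n / m < n => [hw hm hn|].
  by case: (ltngtP m n) => // h; [|symmetry]; apply: hw.
rewrite /gdist; case: n lt_mn => [|n] //= le_mn /andP [hm _] /andP [_].
by rewrite (ball_mono m n _ _ le_mn hm).
Qed.

(** Double counting of the edges between [A] and [B], sorted by either endpoint. *)
Lemma edge_count_sym (A B : {set T}) : symmetric e ->
  \sum_(y in A) #|[set x in B | e y x]| = \sum_(x in B) #|[set y in A | e x y]|.
Proof.
move=> esym; under eq_bigr => y _ do rewrite -sum1dep_card.
under [RHS]eq_bigr => y _ do rewrite -sum1dep_card.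
rewrite (exchange_big_dep (mem B)) /=; last by move=> y x _ /andP [].
by apply: eq_bigr => x hx; apply: eq_bigl => y; rewrite hx esym.
Qed.

End Ball.

(** * The distance function and geodesics *)

Section DistanceRegular.
Local Open Scope nat_scope.
Context {T : finType} {e : rel T} {d : nat} {a b c : nat -> nat}.
Hypothesis dr : distance_regular e d a b c.
Implicit Types (u v w x y z : T) (h i : nat).

Let esym : symmetric e. Proof. by case: dr. Qed.

Lemma gdist_ex v w : exists i, gdist e v w i.
Proof. by case: dr => _ _ /(_ v w) [i _ ?] _ _; exists i. Qed.

Definition dist v w : nat := ex_minn (gdist_ex v w).

Lemma gdistE v w i : gdist e v w i = (dist v w == i).
Proof.
rewrite /dist; case: ex_minnP => m hm _; apply/idP/eqP => [h|<- //].
exact: gdist_inj hm h.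
Qed.

Lemma ballE v w i : (w \in ball e i v) = (dist v w <= i).
Proof.
have := eqxx (dist v w); rewrite -gdistE => /andP [hin hout].
apply/idP/idP => [h|h]; last exact: ball_mono _ _ _ _ h hin.
rewrite leqNgt; apply/negP => lt_i; move: hout.
have -> : (dist v w == 0) = false by lia.
by rewrite (@ball_mono _ _ i) //; lia.
Qed.

Lemma dist_le v w : dist v w <= d.
Proof. by case: dr => _ _ /(_ v w) [i hi]; rewrite gdistE => /eqP ->. Qed.

Lemma distC v w : dist v w = dist w v.
Proof.
have le x y : dist x y <= dist y x by rewrite -ballE; apply: ball_sym; rewrite ?ballE.
by apply/eqP; rewrite eqn_leq !le.
Qed.

Lemma dist_eq0 v w : (dist v w == 0) = (w == v).
Proof. by rewrite -leqn0 -ballE /= inE. Qed.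

Lemma distvv v : dist v v = 0.
Proof. by apply/eqP; rewrite dist_eq0. Qed.

Lemma dist_edge v u w : e u w -> dist v w <= (dist v u).+1.
Proof. by move=> euw; rewrite -ballE; apply: ball_edge euw; rewrite ballE. Qed.

Lemma dist_edgeC v u w : e u w -> dist u v <= (dist w v).+1.
Proof. by rewrite esym !(distC _ v); apply: dist_edge. Qed.

Lemma dist_pred v w i : dist v w = i.+1 -> exists2 u, e w u & dist v u = i.
Proof.
move=> hd; have := leqnn (dist v w).
rewrite {2}hd -ballE mem_ballS ballE hd ltnn /= => /exists_inP [u].
rewrite ballE => hu euw; exists u; first by rewrite esym.
by have := dist_edge v _ _ euw; lia.
Qed.

Lemma dist_triangle u v w : dist v w <= dist v u + dist u w.
Proof.
move: {2}(dist u w) (erefl (dist u w)) => n; elim: n w => [|n IH] w hn.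
  by move/eqP: hn; rewrite dist_eq0 => /eqP ->; rewrite distvv addn0.
have [z ewz hz] := dist_pred _ _ _ hn; rewrite esym in ewz.
by have := IH _ hz; have := dist_edge v _ _ ewz; lia.
Qed.

Lemma dist_geodesic v w i : i <= dist v w ->
  exists2 u, dist v u = i & dist u w = dist v w - i.
Proof.
(* The upper bound on [dist u w] suffices: the triangle inequality forces equality. *)
move=> hi; suff [u hu] : exists2 u, dist v u = i & dist u w <= dist v w - i.
  by move=> hw; exists u => //; have := dist_triangle u v w; lia.
move: {2}(dist v w - i) (erefl (dist v w - i)) => n.
elim: n w hi => [|n IH] w hi hn; first by exists w; rewrite ?distvv; lia.
have [z ewz hz] := @dist_pred v w (dist v w).-1 ltac:(lia).
have [|| u hu hu'] := IH z; [lia..|exists u => //].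
by rewrite esym in ewz; have := dist_edge u _ _ ewz; lia.
Qed.

Lemma dist_exists i : i <= d -> exists v w, dist v w = i.
Proof.
case: dr => _ _ _ [v [w hd]] _ hi; move: hd; rewrite gdistE => /eqP hd.
by have [|u hu _] := @dist_geodesic v w i; [lia|exists v, u].
Qed.

(** * Intersection numbers: positivity and monotonicity *)

Lemma card_succ v w i : dist v w = i ->
  #|[set u | e w u & dist v u == i.+1]| = b i.
Proof.
move=> hd; case: dr => _ _ _ _ /(_ i v w); rewrite gdistE hd -{1}hd => h.
have [_ _ <-] := h (dist_le v w) (eqxx _).
by congr #|pred_of_set _|; apply/setP => u; rewrite !inE gdistE.
Qed.

Lemma card_pred v w i : dist v w = i.+1 ->
  #|[set u | e w u & dist v u == i]| = c i.+1.
Proof.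
move=> hd; case: dr => _ _ _ _ /(_ i.+1 v w); rewrite gdistE hd -{1}hd => h.
have [<- _ _] := h (dist_le v w) (eqxx _).
by congr #|pred_of_set _|; apply/setP => u; rewrite !inE gdistE.
Qed.

Lemma b_gt0 i : i < d -> 0 < b i.
Proof.
move=> /dist_exists [v [w hd]]; have [u ewu hu] := dist_pred _ _ _ hd.
by rewrite -(card_succ _ _ _ hu); apply/card_gt0P; exists w; rewrite inE esym ewu hd /=.
Qed.

Lemma c_gt0 i : i < d -> 0 < c i.+1.
Proof.
move=> /dist_exists [v [w hd]]; have [u ewu hu] := dist_pred _ _ _ hd.
by rewrite -(card_pred _ _ _ hd); apply/card_gt0P; exists u; rewrite inE ewu hu /=.
Qed.

(** Let [u] follow [v] on a geodesic to [w]: a neighbour of [w] that is further from [v] is also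
    further from [u]. *)
Lemma b_step i : i < d -> b i.+1 <= b i.
Proof.
move=> /dist_exists [v [w hd]].
have [u evu hu] : exists2 u, e v u & dist u w = i.
  by rewrite distC in hd; have [u] := dist_pred _ _ _ hd; exists u; rewrite 1?distC.
rewrite -(card_succ _ _ _ hu) -(card_succ _ _ _ hd); apply: subset_leq_card.
apply/subsetP => x; rewrite !inE => /andP [ewx /eqP hx]; rewrite ewx /=.
by have := dist_edgeC x _ _ evu; have := dist_edge u _ _ ewx; lia.
Qed.

Lemma b_mono i h : i <= h -> h <= d -> b h <= b i.
Proof.
move=> /subnKC <-; elim: (h - i) => [|k IH]; rewrite ?addn0 // addnS => lt_d.
by apply: leq_trans (IH _); [apply: b_step|lia].
Qed.

(** With [u] next to [v] on a geodesic to [w], a neighbour of [w] that is closer to [u] is also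
    closer to [v]. *)
Lemma c_step i : i.+1 < d -> c i.+1 <= c i.+2.
Proof.
move=> /dist_exists [v [w hd]].
have [u evu hu] : exists2 u, e v u & dist u w = i.+1.
  by rewrite distC in hd; have [u] := dist_pred _ _ _ hd; exists u; rewrite 1?distC.
rewrite -(card_pred _ _ _ hu) -(card_pred _ _ _ hd); apply: subset_leq_card.
apply/subsetP => x; rewrite !inE => /andP [ewx /eqP hx]; rewrite ewx /=.
rewrite esym in ewx.
by have := dist_edgeC x _ _ evu; have := dist_edge v _ _ ewx; lia.
Qed.

Lemma c_mono i h : i <= h -> h < d -> c i.+1 <= c h.+1.
Proof.
move=> /subnKC <-; elim: (h - i) => [|k IH]; rewrite ?addn0 // addnS => lt_d.
by apply: leq_trans (IH _) _; [lia|apply: c_step].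
Qed.

(** * Sphere sizes and counting bounds *)

Definition sphere v i : {set T} := [set x | dist v x == i].

Lemma sphere0 v : sphere v 0 = [set v].
Proof. by apply/setP => x; rewrite !inE dist_eq0. Qed.

(** Both sides count the edges between two consecutive spheres. *)
Lemma card_sphereS v i : c i.+1 * #|sphere v i.+1| = b i * #|sphere v i|.
Proof.
rewrite !(mulnC _ #|_|) -!sum_nat_const.
have := edge_count_sym (sphere v i) (sphere v i.+1) esym.
rewrite (eq_bigr (fun=> b i)); last first.
  move=> y; rewrite inE => /eqP hy; rewrite -(card_succ _ _ _ hy).
  by apply: eq_card => x; rewrite !inE andbC.
move=> ->; apply: eq_bigr => y; rewrite inE => /eqP hy.
by rewrite -(card_pred _ _ _ hy); apply: eq_card => x; rewrite !inE andbC.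
Qed.

Lemma card_sphere_const u v i : i <= d -> #|sphere u i| = #|sphere v i|.
Proof.
elim: i => [|i IH] lt_d; first by rewrite !sphere0 !cards1.
apply/eqP; rewrite -(eqn_pmul2l (c_gt0 _ lt_d)) !card_sphereS IH //; exact: ltnW.
Qed.

Lemma card_sphere_gt0 v i : i <= d -> 0 < #|sphere v i|.
Proof.
move=> /[dup] hi /dist_exists [u [w hu]]; rewrite (card_sphere_const v u) //.
by apply/card_gt0P; exists w; rewrite inE hu.
Qed.

(* The two sides of [step] count the edges between the sets for [i] and [i.+1]: every
   neighbour that is one step closer to [u], or one step further from [w], is forced
   into the right set by the other distance. *)
Lemma card_edge_split u w i : e u w -> i <= d ->
  b 0 * #|[set x | (dist u x == i) && (dist w x == i.+1)]| = b i * #|sphere u i|.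
Proof.
move=> euw; have dwu : dist w u = 1.
  case: dr => _ eirr _ _ _; have := dist_edge w w u; rewrite esym euw distvv.
  move/(_ isT); case: (dist w u =P 0) => [/eqP|]; last lia.
  by rewrite dist_eq0 => /eqP huw; move: euw; rewrite huw eirr.
elim: i => [|i IH] lt_d.
  congr (_ * _); rewrite sphere0; apply: eq_card => x; rewrite !inE dist_eq0.
  by case: eqP => // ->; rewrite dwu.
have step : c i.+1 * #|[set x | (dist u x == i.+1) && (dist w x == i.+2)]| =
            b i.+1 * #|[set x | (dist u x == i) && (dist w x == i.+1)]|.
  set A := [set x | (dist u x == i) && _]; set B := [set x | _].
  rewrite !(mulnC _ #|_|) -!sum_nat_const.
  transitivity (\sum_(x in B) #|[set y in A | e x y]|).
    apply: eq_bigr => x; rewrite inE => /andP [/eqP hu /eqP hw].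
    rewrite -(card_pred _ _ _ hu); apply: eq_card => y; rewrite !inE andbC.
    case exy: (e x y); rewrite ?andbF ?andbT //.
    have := dist_edgeC y w u; rewrite esym euw => /(_ isT).
    by rewrite esym in exy; have := dist_edge w _ _ exy; lia.
  rewrite -edge_count_sym //; apply: eq_bigr => y; rewrite inE => /andP [/eqP hu /eqP hw].
  rewrite -(card_succ _ _ _ hw); apply: eq_card => x; rewrite !inE andbC.
  case eyx: (e y x); rewrite ?andbF ?andbT //.
  have := dist_edgeC x w u; rewrite esym euw => /(_ isT).
  by have := dist_edge u _ _ eyx; lia.
apply/eqP; rewrite -(eqn_pmul2l (c_gt0 _ lt_d)) mulnCA step.
by rewrite [X in _ == X]mulnCA card_sphereS -IH; [apply/eqP; ring|lia].
Qed.

(** Induction along a geodesic from [u] to [v] with first step [w]: a point of the difference lies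
    in [ball e h w :\: ball e h v], or is at distance [h] from [u] and [h.+1] from [w], a set
    counted by [card_edge_split]. *)
Lemma card_ballD u v h : h <= d ->
  b 0 * #|ball e h u :\: ball e h v| <= dist u v * (b h * #|sphere u h|).
Proof.
move=> hh; move: {2}(dist u v) (erefl (dist u v)) => n.
elim: n u => [|n IH] u hn.
  by move/eqP: hn; rewrite dist_eq0 => /eqP ->; rewrite setDv cards0 muln0.
have [w euw hw] : exists2 w, e u w & dist w v = n.
  by rewrite distC in hn; have [w] := dist_pred _ _ _ hn; exists w; rewrite 1?distC.
rewrite hn mulSn -{1}(card_edge_split _ _ _ euw hh) (card_sphere_const u w) // -{1}hw.
apply: leq_trans (leq_add (leqnn _) (IH _ hw)); rewrite -mulnDr leq_mul2l; apply/orP; right.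
apply: leq_trans (leq_card_setU _ _); apply: subset_leq_card; apply/subsetP => x.
rewrite !inE !ballE => /andP [hv hu].
rewrite esym in euw; have := dist_edgeC x _ _ euw.
by case: leqP => hwx; lia.
Qed.

(** By monotonicity of [b] and [c], sphere sizes grow at least by the factor [b j / c j.+1] up to
    radius [j.+1]; this is the resulting geometric sum bound, cleared of denominators. *)
Lemma card_ball_le v i j : j < d -> c j.+1 <= b j -> i <= j ->
  (b j - c j.+1) * #|ball e i v| <= c j.+1 * #|sphere v i.+1|.
Proof.
move=> lt_d le_cb; have grow h : h <= j -> b j * #|sphere v h| <= c j.+1 * #|sphere v h.+1|.
  move=> hj; apply: (@leq_trans (b h * #|sphere v h|)).
    by rewrite leq_mul2r b_mono ?orbT //; lia.
  by rewrite -card_sphereS leq_mul2r c_mono ?orbT.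
elim: i => [|i IH] hi.
  apply: leq_trans (grow _ hi); rewrite /= sphere0 leq_mul2r leq_subr orbT //.
apply: leq_trans (grow _ hi).
have -> : ball e i.+1 v = ball e i v :|: sphere v i.+1.
  by apply/setP => x; rewrite in_setU !ballE inE; lia.
apply: leq_trans (leq_mul (leqnn _) (leq_card_setU _ _)) _.
rewrite mulnDr; apply: leq_trans (leq_add (IH _) (leqnn _)) _; first exact: ltnW.
(* The bound for the smaller ball supplies the missing [c j.+1] copies of the sphere. *)
by rewrite -mulnDl subnKC.
Qed.

(* Along an edge leaving [sphere v i], the distance to [w] drops from [h.+1] to [h]
   for at most [c h.+1] endpoints. *)
Lemma card_sphere_near v w h i :
  c i.+1 * #|[set x in sphere v i.+1 | dist w x <= h]| <=
  b i * #|[set x in sphere v i | dist w x <= h]| + c h.+1 * #|sphere v i|.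
Proof.
set F := [set x in sphere v i.+1 | _]; rewrite !(mulnC _ #|_|) -!sum_nat_const.
have -> : \sum_(x in F) c i.+1 = \sum_(x in F) #|[set y in sphere v i | e x y]|.
  apply: eq_bigr => x; rewrite !inE => /andP [/eqP hx _].
  by rewrite -(card_pred _ _ _ hx); apply: eq_card => y; rewrite !inE andbC.
rewrite -edge_count_sym //.
rewrite [X in X + _](eq_bigl (fun x => (x \in sphere v i) && (dist w x <= h))); last first.
  by move=> x; rewrite inE.
(* With the condition moved into the summand, the bound is checked at each [y] of the sphere
   separately. *)
rewrite big_mkcondr -big_split /=; apply: leq_sum => y; rewrite inE => /eqP hy.
case: (leqP (dist w y) h) => [_|lt_h] /=.
  rewrite -[X in (X <= _)%N]addn0 leq_add // -(card_succ _ _ _ hy); apply: subset_leq_card.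
  by apply/subsetP => x; rewrite !inE => /andP [/andP [hx _] ->].
(* An edge from outside the ball around [w] into [F] must start at distance exactly [h.+1]. *)
have drop x : x \in F -> e y x -> dist w y = h.+1 /\ dist w x = h.
  rewrite !inE => /andP [_ hx]; rewrite esym => exy.
  by have := dist_edge w _ _ exy; lia.
case: (dist w y =P h.+1) => [hw|hw].
  rewrite -(card_pred _ _ _ hw); apply: subset_leq_card; apply/subsetP => x.
  by rewrite inE => /andP [hx exy]; rewrite inE exy; have [_ ->] := drop x hx exy; rewrite eqxx.
rewrite (_ : [set x in F | e y x] = set0) ?cards0 //; apply/setP => x.
by rewrite inE in_set0; apply/negP => /andP [hx /(drop x hx) []].
Qed.

(** * Proportions of a sphere, over the rationals *)

Local Open Scope ring_scope.

Definition inv_b_sum n : rat := \sum_(1 <= t < n.+1) (b t.-1)%:R^-1.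

Lemma inv_b_sumS n : inv_b_sum n.+1 = inv_b_sum n + (b n)%:R^-1.
Proof. by rewrite /inv_b_sum big_nat_recr. Qed.

Lemma inv_b_sum_ge n : (n <= d)%N -> n%:R / (b 0)%:R <= inv_b_sum n.
Proof.
elim: n => [|n IH] lt_d; first by rewrite mul0r /inv_b_sum big_geq.
rewrite inv_b_sumS -addn1 natrD mulrDl mul1r lerD ?IH //; first exact: ltnW.
have bn_gt0 := b_gt0 n lt_d.
by rewrite lef_pV2 ?posrE ?ltr0n ?ler_nat ?b_gt0 ?b_mono //; lia.
Qed.

Lemma ballD_ratio u v h : (h <= d)%N -> (0 < d)%N ->
  #|ball e h u :\: ball e h v|%:R / #|sphere u h|%:R <=
  (b h)%:R * inv_b_sum (dist u v).
Proof.
move=> hh d_gt0; have k_gt0 := card_sphere_gt0 u h hh.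
have b0_gt0 := b_gt0 0 d_gt0.
apply: le_trans (_ : (b h)%:R * ((dist u v)%:R / (b 0)%:R) <= _); last first.
  by rewrite ler_wpM2l // inv_b_sum_ge // dist_le.
rewrite ler_pdivrMr ?ltr0n // mulrA mulrAC ler_pdivlMr ?ltr0n // -!natrM ler_nat.
by have := card_ballD u v h hh; lia.
Qed.

(** Dividing [card_sphere_near] by [b i * #|sphere v i|], which equals [c i.+1 * #|sphere v i.+1|],
    shows that each step adds at most [c h.+1 / b i]. The proportion starts at 0, as [v] is outside
    the ball around [w]. *)
Lemma sphere_near_ratio v w h i : dist v w = h.+1 -> (i <= d)%N ->
  #|[set x in sphere v i | (dist w x <= h)%N]|%:R / #|sphere v i|%:R <=
  (c h.+1)%:R * inv_b_sum i.
Proof.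
move=> hd; elim: i => [|i IH] lt_d.
  rewrite [X in #|pred_of_set X|%:R](_ : _ = set0); last first.
    apply/setP => x; rewrite sphere0 !inE; case: eqP => // ->.
    by rewrite distC hd ltnn.
  by rewrite cards0 mul0r /inv_b_sum big_geq // mulr0.
have leF := card_sphere_near v w h i; have kS := card_sphereS v i.
have k_gt0 := card_sphere_gt0 v i (ltnW lt_d).
have k'_gt0 := card_sphere_gt0 v _ lt_d.
have bi_gt0 := b_gt0 i lt_d; have ci_gt0 := c_gt0 i lt_d.
rewrite inv_b_sumS mulrDr; apply: le_trans (lerD (IH (ltnW lt_d)) (lexx _)).
set F' := [set x in sphere v i.+1 | _] in leF *.
set F := [set x in sphere v i | _] in leF *.
have -> : #|F'|%:R / #|sphere v i.+1|%:R =
    (c i.+1 * #|F'|)%:R / (b i * #|sphere v i|)%:R :> rat.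
  by rewrite -kS !natrM; field; rewrite !pnatr_eq0; lia.
have -> : #|F|%:R / #|sphere v i|%:R + (c h.+1)%:R / (b i)%:R =
    (b i * #|F| + c h.+1 * #|sphere v i|)%:R / (b i * #|sphere v i|)%:R :> rat.
  by rewrite natrD !natrM; field; rewrite !pnatr_eq0; lia.
by rewrite ler_wpM2r ?invr_ge0 ?ler_nat.
Qed.

Lemma ball_ratio v j : (j < d)%N -> (c j.+1 < b j)%N ->
  #|ball e j v|%:R / #|sphere v j.+1|%:R <= ((b j)%:R / (c j.+1)%:R - 1)^-1 :> rat.
Proof.
move=> lt_d lt_cb; have := card_ball_le v j j lt_d (ltnW lt_cb) (leqnn j).
have k_gt0 := card_sphere_gt0 v _ lt_d; have cj_gt0 := c_gt0 j lt_d.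
rewrite -(ler_nat rat) !natrM natrB; last exact: ltnW.
have bc_gt0 : 0 < (b j)%:R - (c j.+1)%:R :> rat by rewrite subr_gt0 ltr_nat.
have -> : ((b j)%:R / (c j.+1)%:R - 1)^-1 = (c j.+1)%:R / ((b j)%:R - (c j.+1)%:R) :> rat.
  by field; rewrite !pnatr_eq0 gt_eqF //; lia.
by move=> le; rewrite ler_pdivrMr ?ltr0n // mulrAC ler_pdivlMr // mulrC.
Qed.

(** A point within [j.+1] of both [v] and [w] is either within [j] of [v] or exactly at [j.+1] from
    it. *)
Lemma card_sphere_cover u v w j :
  (#|sphere u j.+1| <= #|ball e j.+1 u :\: ball e j.+1 v| +
     #|ball e j.+1 u :\: ball e j.+1 w| + #|ball e j v| +
     #|[set x in sphere v j.+1 | dist w x <= j.+1]|)%N.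
Proof.
pose A := ball e j.+1 u :\: ball e j.+1 v; pose B := ball e j.+1 u :\: ball e j.+1 w.
pose F := [set x in sphere v j.+1 | (dist w x <= j.+1)%N].
apply: (@leq_trans #|A :|: B :|: ball e j v :|: F|%N).
  apply: subset_leq_card; apply/subsetP => x.
  rewrite !in_setU !in_setD !ballE !inE; lia.
do 3![apply: leq_trans (leq_card_setU _ _) _; rewrite ?leq_add2r //].
Qed.

End DistanceRegular.

(** * Assembling the inequality *)

Theorem theorem3p2 (T : finType) (e : rel T) (d : nat) (a b c : nat -> nat)
    (j s : nat) :
  distance_regular e d a b c ->
  (2 <= d)%N ->
  (j <= d - 2)%N ->
  (b j > c j.+1)%N ->
  (1 <= s <= j.+1)%N ->
  let C : rat := (b j)%:R / (c j.+1)%:R in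
  (b j.+1)%:R * (\sum_(1 <= t < s.+1) ((b t.-1)%:R)^-1
                 + \sum_(1 <= t < (j + 2 - s).+1) ((b t.-1)%:R)^-1)
  + (c j.+2)%:R * \sum_(1 <= t < j.+2) ((b t.-1)%:R)^-1
  >= 1 - 4 / (C - 1).
Proof.
move=> dr d_ge2 le_jd lt_cb /andP [s_ge1 s_le]; cbv zeta; set C := _ / (c j.+1)%:R.
have [v [w hvw]] := dist_exists dr j.+2 ltac:(lia).
have [|u hvu huw] := dist_geodesic dr v w s; first by rewrite hvw; lia.
rewrite hvw in huw; rewrite (distC dr) in hvu.
have lt_jd : (j < d)%N by lia.
have d_gt0 : (0 < d)%N by lia.
have := ballD_ratio dr u v j.+1 lt_jd d_gt0.
have := ballD_ratio dr u w j.+1 lt_jd d_gt0.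
have := ball_ratio dr v j lt_jd lt_cb.
have := sphere_near_ratio dr v w j.+1 j.+1 hvw lt_jd.
have := card_sphere_cover dr u v w j.
rewrite (card_sphere_const dr v u) // hvu huw.
have := card_sphere_gt0 dr u j.+1 lt_jd; set K := #|sphere dr u j.+1| => K_gt0.
(* Dividing the cover by the common sphere size [K] turns its four terms into the four proportions
   bounded above. *)
rewrite -(ler_nat rat) -(ler_pM2r (_ : 0 < K%:R^-1)) ?invr_gt0 ?ltr0n //.
rewrite divff ?pnatr_eq0 -?lt0n // !natrD !mulrDl /inv_b_sum.
have -> : (j.+2 - s = j + 2 - s)%N by lia.
(* The bounds add up to the stronger constant [1 - 1 / (C - 1)]; positivity allows weakening it to
   [1 - 4 / (C - 1)]. *)
have : 0 < (C - 1)^-1.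
  by rewrite invr_gt0 subr_gt0 ltr_pdivlMr ?mul1r ?ltr_nat ?ltr0n // (c_gt0 dr).
rewrite -/C; lra.
Qed.
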